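(* Let $G^\sigma$ be an oriented graph whose underlying graph $G$ is a simple connected graph with $n$ vertices and $m$ edges. Then $$sr(G^\sigma)+\alpha(G)\geqslant 4n-2m-\sqrt{n(n-1)-2m+\tfrac{1}{4}}-\tfrac{5}{2},$$ with equality if and only if $G\cong S_n$ or $G\cong C_3$.
   Context: An oriented graph $G^\sigma$ is obtained from a simple graph $G$ by assigning a direction to each edge. Its skew-adjacency matrix $S(G^\sigma)=[s_{x,y}]$ has $s_{x,y}=1$ if there is an arc from $x$ to $y$, $s_{x,y}=-1$ if there is an arc from $y$ to $x$, and $0$ otherwise; the skew-rank $sr(G^\sigma)$ is the rank of $S(G^\sigma)$. $\alpha(G)$ is the independence number of $G$. $S_n$ denotes the star on $n$ vertices (the single vertex when $n=1$) and $C_3$ the triangle. *)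

(* Defs.v *)
From HB Require Import structures.
From mathcomp Require Import all_boot all_order all_algebra.
Set Implicit Arguments. Unset Strict Implicit. Unset Printing Implicit Defensive.
Import Order.TTheory GRing.Theory Num.Theory.

Definition oriented (T : finType) (arc : rel T) : Prop :=
  (forall x, ~~ arc x x) /\ (forall x y, ~~ (arc x y && arc y x)).

Definition underlying (T : finType) (arc : rel T) : rel T :=
  fun x y => arc x y || arc y x.

Definition connected_graph (T : finType) (e : rel T) : Prop :=
  forall x y, connect e x y.

(* number of edges of the underlying graph = number of arcs *)
Definition num_arcs (T : finType) (arc : rel T) : nat :=
  #|[set p : T * T | arc p.1 p.2]|.

Definition skew_adj (R : pzRingType) (n : nat) (arc : rel 'I_n) : 'M[R]_n :=
  \matrix_(i, j) (if arc i j then 1 else if arc j i then -1 else 0)%R.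

Definition skew_rank (R : fieldType) (n : nat) (arc : rel 'I_n) : nat :=
  \rank (skew_adj R arc).

Definition independent (T : finType) (e : rel T) (S : {set T}) : bool :=
  [forall x in S, forall y in S, ~~ e x y].

Definition independence_number (T : finType) (e : rel T) : nat :=
  \max_(S : {set T} | independent e S) #|S|.

Definition graph_iso (T1 T2 : finType) (e1 : rel T1) (e2 : rel T2) : Prop :=
  exists f : T1 -> T2, bijective f /\ forall x y, e1 x y = e2 (f x) (f y).

Definition star_rel (n : nat) : rel 'I_n :=
  fun x y => (x != y) && ((val x == 0%N) || (val y == 0%N)).

Definition triangle_rel : rel 'I_3 := fun x y => x != y.
Arguments star_rel : clear implicits.

(* Main.v *)
(** Write [s], [a] for the skew-rank and the independence number.

    Fix a breadth-first spanning tree and delete one endpoint of each of the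
    [m - n + 1] edges outside it.  What remains induces a forest on at least
    [2n - m - 1] vertices.  Peeling off leaves of a forest on [W] (a pendant edge
    adds 2 to the rank and 1 to the independent set, an isolated vertex adds 1 to
    the independent set) yields [2 #|W| <= s + 2 a], hence
    [4n - 2m - 2 <= s + 2 a].  Counting the pairs inside a maximum independent
    set gives [a (a - 1) <= n (n - 1) - 2m], and the two inequalities add up to the
    bound.  Equality forces the graph to be the join of a clique on [k = n - a]
    vertices with [a] isolated ones, and then the first equality, together with
    [s > 0], leaves only [k <= 1] or [k = 2, a = 1]. *)

Require Import Defs.
From HB Require Import structures.
From mathcomp Require Import all_boot all_order all_algebra.
From mathcomp Require Import perm zify lra.
Import Order.TTheory GRing.Theory Num.Theory.
Set Implicit Arguments. Unset Strict Implicit. Unset Printing Implicit Defensive.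
Local Open Scope ring_scope.

(** * Underlying graph, matrix pattern and independent sets *)

Lemma underlying_sym (T : finType) (arc : rel T) : symmetric (underlying arc).
Proof. by move=> x y; rewrite /underlying orbC. Qed.

Lemma underlying_irrefl (T : finType) (arc : rel T) :
  oriented arc -> irreflexive (underlying arc).
Proof. by move=> [irr _] x; rewrite /underlying orbb; apply/negbTE. Qed.

Lemma skew_adj_neq0 (F : fieldType) n (arc : rel 'I_n) i j :
  (skew_adj F arc i j != 0) = underlying arc i j.
Proof.
rewrite mxE /underlying; case: (arc i j); first by rewrite oner_eq0.
by case: (arc j i); rewrite /= ?oppr_eq0 ?oner_eq0 ?eqxx.
Qed.

Lemma independentP (T : finType) (e : rel T) (I : {set T}) :
  reflect {in I &, forall x y, ~~ e x y} (independent e I).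
Proof.
apply: (iffP forall_inP) => [h x y xI yI | h x xI].
  by move/forall_inP: (h x xI); apply.
by apply/forall_inP => y; apply: h.
Qed.

Section IndependenceNumber.
Variables (T : finType) (e : rel T).

Lemma leq_independence_number (I : {set T}) :
  independent e I -> (#|I| <= independence_number e)%N.
Proof. by move=> indI; apply: (leq_bigmax_cond (F := fun S : {set T} => #|S|)). Qed.

Lemma maximum_independent_set :
  exists2 I : {set T}, independent e I & #|I| = independence_number e.
Proof.
have ind0 : independent e set0 by apply/independentP => x y; rewrite inE.
have pos : (0 < #|independent e|)%N by apply/card_gt0P; exists set0.
have [I indI eqI] := eq_bigmax_cond (fun S : {set T} => #|S|) pos.
by exists I; rewrite // /independence_number eqI.
Qed.

Lemma independence_number_gt0 (x : T) :
  irreflexive e -> (0 < independence_number e)%N.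
Proof.
move=> irr; rewrite -(cards1 x); apply: leq_independence_number.
by apply/independentP => u v /set1P -> /set1P ->; rewrite irr.
Qed.

End IndependenceNumber.

(** * Breadth-first spanning tree and a large induced forest *)

Section SpanningTree.
Variables (T : finType) (e : rel T) (r : T).
Hypothesis conn : connected_graph e.

(** Take for [h] the distance from [r]: the last vertex but one of a shortest path to [v] is
    adjacent to [v] and strictly closer. *)
Lemma bfs_height : exists h : T -> nat,
  forall v, v != r -> exists2 u, e u v & (h u < h v)%N.
Proof.
pose reach v k := [exists s : k.-tuple T, path e r s && (last r s == v)].
have reachP v (s : seq T) : path e r s -> last r s = v -> reach v (size s).
  by move=> es ls; apply/existsP; exists (in_tuple s); rewrite es ls eqxx.
have exr v : exists k, reach v k.
  by have /connectP[s es ->] := conn r v; exists (size s); apply: reachP.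
exists (fun v => ex_minn (exr v)) => v vr.
case: (ex_minnP (exr v)) => k /existsP[s /andP[es /eqP ls]] _.
case/lastP: {s}(val s) (size_tuple s) es ls => [|s w] <-.
  by move=> _ /= rv; rewrite rv eqxx in vr.
rewrite rcons_path last_rcons size_rcons => /andP[es ew] <-; exists (last r s) => //.
by case: ex_minnP => j _; apply; apply: reachP.
Qed.

Lemma bfs_tree : exists (h : T -> nat) (p : T -> T),
  forall v, v != r -> e (p v) v && (h (p v) < h v)%N.
Proof.
have [h hP] := bfs_height.
(* For [v != r] the [pick] succeeds, so the default [v] matters at the root only. *)
exists h, (fun v => odflt v [pick u | e u v && (h u < h v)%N]) => v /hP[u euv huv].
by case: pickP => [//| /(_ u)]; rewrite euv huv.
Qed.

End SpanningTree.

Section Tree.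
Variables (T : finType) (h : T -> nat) (p : T -> T).

(** Each vertex has at most one parent and heights drop towards it, so this is a forest for
    arbitrary [h] and [p]. *)
Definition tree_edge : rel T :=
  fun x y => (p x == y) && (h y < h x)%N || (p y == x) && (h x < h y)%N.

Lemma tree_edge_sym : symmetric tree_edge.
Proof. by move=> x y; rewrite /tree_edge orbC. Qed.

Variable arc : rel T.

(** Each [v != r] is sent to the arc joining it to its parent. The map is injective, since [v] is
    the endpoint of greater height. *)
Lemma leq_tree_arcs (r : T) :
  (forall v, v != r -> underlying arc (p v) v && (h (p v) < h v)%N) ->
  (#|T| <= #|[set a : T * T | arc a.1 a.2 && tree_edge a.1 a.2]|.+1)%N.
Proof.
move=> tree; set A := [set a | _].
pose f v := if arc (p v) v then (p v, v) else (v, p v).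
have fA v : v != r -> f v \in A.
  move=> /tree /andP[+ hv]; rewrite /f /underlying; case: ifP => [av _|_ /= av];
    by rewrite inE /= av /tree_edge eqxx hv ?orbT.
have f_inj : {in [set~ r] &, injective f}.
  have deep v : v != r -> v = if (h (f v).1 < h (f v).2)%N then (f v).2 else (f v).1.
    move=> /tree /andP[_ hv]; rewrite /f; case: (arc (p v) v) => /=; first by rewrite hv.
    by rewrite ltnNge (ltnW hv).
  by move=> v w; rewrite !inE => /deep dv /deep dw fvw; rewrite dv dw fvw.
rewrite -(prednK (n := #|T|)) ?ltnS; last by apply/card_gt0P; exists r.
rewrite -(cardsC1 r) -(card_in_imset f_inj); apply: subset_leq_card.
by apply/subsetP => _ /imsetP[v vr ->]; apply: fA; rewrite !inE in vr.
Qed.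

(** Deleting the tail [a.1] of every non-tree arc leaves only tree edges. As at least [n - 1] arcs
    are tree arcs, at most [m - n + 1] vertices go. *)
Lemma large_forest (r : T) :
  (forall v, v != r -> underlying arc (p v) v && (h (p v) < h v)%N) ->
  exists2 W : {set T}, {in W &, forall x y, underlying arc x y -> tree_edge x y}
    & (2 * #|T| <= num_arcs arc + #|W| + 1)%N.
Proof.
move=> /leq_tree_arcs; set A := [set a | _] => leA.
pose B := [set a : T * T | arc a.1 a.2 && ~~ tree_edge a.1 a.2].
exists (~: [set a.1 | a in B]).
  have noarc x y : x \in ~: [set a.1 | a in B] -> arc x y -> tree_edge x y.
    rewrite inE => xB axy; apply: contraR xB => txy.
    by apply/imsetP; exists (x, y); rewrite // inE /= axy.
  move=> x y xW yW /orP[/(noarc _ _ xW)//|/(noarc _ _ yW)].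
  by rewrite tree_edge_sym.
have cardAB : (#|A| + #|B|)%N = num_arcs arc.
  rewrite /num_arcs -[RHS](cardsID [set a : T * T | tree_edge a.1 a.2]).
  by congr (_ + _)%N; apply: eq_card => a; rewrite !inE // andbC.
have leB : (#|[set a.1 | a in B]| <= #|B|)%N := leq_imset_card _ _.
have := cardsC [set a.1 | a in B]; lia.
Qed.

End Tree.

(** * Rank and independent sets from peeling a forest *)

Section NonsingularOn.
Variables (F : fieldType) (n : nat) (A : 'M[F]_n).

Definition nonsingular_on (U : {set 'I_n}) : Prop :=
  forall v : 'rV[F]_n, (forall i, i \notin U -> v 0 i = 0) ->
    (forall j, j \in U -> (v *m A) 0 j = 0) -> v = 0.

Lemma nonsingular_on_rank (U : {set 'I_n}) :
  nonsingular_on U -> (#|U| <= \rank A)%N.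
Proof.
(* [B] consists of the rows of the identity indexed by [U]; [w *m B] extends [w] by zero. *)
move=> nsU; pose B : 'M[F]_(#|U|, n) := rowsub (@enum_val _ (mem U)) 1%:M.
have wB (w : 'rV_#|U|) k : (w *m B) 0 (enum_val k) = w 0 k.
  rewrite mxE (bigD1 k) //= big1 ?addr0; first by rewrite !mxE eqxx mulr1.
  by move=> l lk; rewrite !mxE (inj_eq enum_val_inj) (negbTE lk) mulr0.
have /eqP <- : row_free (B *m A).
  apply: inj_row_free => w; rewrite mulmxA => wBA0.
  have wB0 : w *m B = 0.
    apply: nsU => [i iU|j _]; last by rewrite wBA0 mxE.
    rewrite mxE big1 // => k _; rewrite !mxE.
    by case: eqP => [ki|]; rewrite ?mulr0 // -ki (enum_valP k) in iU *.
  by apply/rowP => k; rewrite -wB wB0 !mxE.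
exact: mxrankM_maxr.
Qed.

(** For a kernel vector [v], column [x] forces [v 0 y = 0]. Removing the [x] coordinate then leaves
    a kernel vector on [U], hence 0, and column [y] forces [v 0 x = 0]. *)
Lemma nonsingular_on_pendant (U : {set 'I_n}) (x y : 'I_n) :
  x != y -> x \notin U -> y \notin U -> A x x = 0 -> A x y != 0 -> A y x != 0 ->
  {in U, forall z, A x z = 0 /\ A z x = 0} ->
  nonsingular_on U -> nonsingular_on (x |: (y |: U)).
Proof.
move=> xy xU yU Axx Axy Ayx zero nsU v supp vA.
have vy : v 0 y = 0.
  have := vA x; rewrite !inE eqxx => /(_ isT).
  rewrite mxE (bigD1 y) //= big1 ?addr0 => [|i iy].
    by move/eqP; rewrite mulf_eq0 (negbTE Ayx) orbF => /eqP.
  have [->|ix] := eqVneq i x; first by rewrite Axx mulr0.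
  have [iU|iU] := boolP (i \in U); first by rewrite (zero i iU).2 mulr0.
  by rewrite supp ?mul0r // !inE negb_or ix negb_or iy.
pose w := v - v 0 x *: delta_mx 0 x.
have wE i : i != x -> w 0 i = v 0 i.
  by move=> ix; rewrite !mxE eqxx (negbTE ix) mulr0 subr0.
have w0 : w = 0.
  apply: nsU => [i iU|j jU].
    have [->|ix] := eqVneq i x; first by rewrite !mxE !eqxx mulr1 subrr.
    have [->|iy] := eqVneq i y; first by rewrite wE // eq_sym.
    by rewrite wE // supp // !inE negb_or ix negb_or iy.
  have rx : row x A 0 j = 0 by rewrite mxE (zero j jU).1.
  have vj : (v *m A) 0 j = 0 by rewrite vA // !inE jU !orbT.
  by rewrite mulmxBl -scalemxAl -rowE mxE vj add0r mxE mxE rx mulr0 oppr0.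
have vE : v = v 0 x *: delta_mx 0 x by apply/eqP; rewrite -subr_eq0 -/w w0.
suff vx : v 0 x = 0 by rewrite vE vx scale0r.
have := vA y; rewrite !inE eqxx orbT => /(_ isT).
rewrite {1}vE -scalemxAl -rowE 2!mxE => /eqP.
by rewrite mulf_eq0 (negbTE Axy) orbF => /eqP.
Qed.

End NonsingularOn.

(** Only the zero pattern of [A] matters. In the induction on [#|W|], [U] collects the pendant
    pairs, and [I] their leaves together with the isolated vertices. *)
Lemma forest_rank_independence (F : fieldType) n (A : 'M[F]_n) (e : rel 'I_n)
    (h : 'I_n -> nat) (p : 'I_n -> 'I_n) (W : {set 'I_n}) :
  symmetric e -> irreflexive e -> (forall i j, (A i j != 0) = e i j) ->
  {in W &, forall x y, e x y -> tree_edge h p x y} ->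
  exists U I : {set 'I_n}, [/\ U \subset W, I \subset W, independent e I,
    nonsingular_on A U & (2 * #|W| <= #|U| + 2 * #|I|)%N].
Proof.
move=> sym irr eA; have Ae0 i j : ~~ e i j -> A i j = 0.
  by rewrite -eA negbK => /eqP.
have [k] := ubnP #|W|; elim: k W => // k IHk W ltW forW.
have [->|/set0Pn[x0 x0W]] := eqVneq W set0.
  exists set0, set0; split; rewrite ?sub0set ?cards0 //.
    by apply/independentP => x y; rewrite inE.
  by move=> v supp _; apply/rowP => i; rewrite supp ?inE ?mxE.
(* A vertex of maximal height has no neighbour in [W] except possibly its parent. *)
have [x xW maxx] : exists2 x, x \in W & {in W, forall z, (h z <= h x)%N}.
  by case: (arg_maxnP h x0W) => x; exists x.
have nb z : z \in W -> e x z -> z = p x.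
  move=> zW exz; case/orP: (forW x z xW zW exz) => /andP[/eqP pz //].
  by rewrite ltnNge => /negP[]; apply: (maxx z zW).
have indx (I : {set 'I_n}) : independent e I -> {in I, forall z, ~~ e x z} ->
    independent e (x |: I).
  move=> /independentP indI exI; apply/independentP => u v.
  case/setU1P => [->|uI] /setU1P[->|vI]; rewrite ?irr ?exI //; last exact: indI.
  by rewrite sym exI.
have IH (W' : {set 'I_n}) : W' \subset W :\ x -> exists U I : {set 'I_n},
    [/\ U \subset W', I \subset W', independent e I,
    nonsingular_on A U & (2 * #|W'| <= #|U| + 2 * #|I|)%N].
  move=> sW'; apply: IHk.
    by apply: leq_ltn_trans (subset_leq_card sW') _; move: ltW; rewrite (cardsD1 x) xW.
  have sW : W' \subset W by apply: subset_trans sW' (subD1set _ _).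
  by move=> u v /(subsetP sW) uW /(subsetP sW); apply: forW.
have cardW := cardsD1 x W; rewrite xW add1n in cardW.
(* If [x] is a leaf hanging at [y], both are removed: [x] and [y] enter [U], [x] enters [I], and
   both sides of the count grow by 4. *)
have [/exists_inP[y yW exy]|noy] := boolP [exists y in W, e x y].
  have xy : x != y by apply: contraTneq exy => <-; rewrite irr.
  have [U [I [sU sI indI nsU le]]] := IH (W :\ x :\ y) (subD1set _ _).
  have notin z : z \in W :\ x :\ y -> ~~ e x z.
    rewrite !inE => /and3P[zy zx zW]; apply: contra zy => /(nb z zW) ->.
    by rewrite (nb y yW exy).
  have yU : y \notin U by apply/negP => /(subsetP sU); rewrite !inE eqxx.
  have xU : x \notin U by apply/negP => /(subsetP sU); rewrite !inE eqxx andbF.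
  have xI : x \notin I by apply/negP => /(subsetP sI); rewrite !inE eqxx andbF.
  have s2 : W :\ x :\ y \subset W by rewrite !(subset_trans (subD1set _ _)).
  exists (x |: (y |: U)), (x |: I); split.
  - by rewrite !subUset !sub1set xW yW (subset_trans sU).
  - by rewrite subUset sub1set xW (subset_trans sI).
  - by apply: indx => // z /(subsetP sI) /notin.
  - apply: nonsingular_on_pendant => //; rewrite ?eA //.
    + by rewrite Ae0 ?irr.
    + by rewrite sym.
    + by move=> z /(subsetP sU) /notin nz; rewrite !Ae0 // sym.
  - rewrite !cardsU1 !inE negb_or xy xU yU xI /=.
    have := cardsD1 y (W :\ x); rewrite !inE yW eq_sym xy /= => cardWx.
    by rewrite cardW cardWx; move: le; move: #|W :\ x :\ y| #|U| #|I| => a b c; lia.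
(* Here [x] is isolated in [W]: it enters [I] only, and both sides grow by 2. *)
have [U [I [sU sI indI nsU le]]] := IH (W :\ x) (subxx _).
have xI : x \notin I by apply/negP => /(subsetP sI); rewrite !inE eqxx.
exists U, (x |: I); split=> //.
- exact: subset_trans sU (subD1set _ _).
- by rewrite subUset sub1set xW (subset_trans sI) ?subD1set.
- apply: indx => // z /(subsetP sI); rewrite !inE => /andP[_ zW].
  by apply: contra noy => exz; apply/exists_inP; exists z.
- by rewrite cardsU1 xI cardW /=; move: le; move: #|W :\ x| #|U| #|I| => a b c; lia.
Qed.

Lemma skew_rank_independence (F : fieldType) n (arc : rel 'I_n) :
  (0 < n)%N -> oriented arc -> connected_graph (underlying arc) ->
  (4 * n <= skew_rank F arc + 2 * independence_number (underlying arc)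
            + 2 * num_arcs arc + 2)%N.
Proof.
move=> n_gt0 ori conn.
have [h [p tree]] := bfs_tree (Ordinal n_gt0) conn.
have [W forW] := large_forest tree; rewrite card_ord => leW.
have [U [I [_ _ indI nsU leUI]]] := forest_rank_independence
  (@underlying_sym _ arc) (underlying_irrefl ori) (@skew_adj_neq0 F n arc) forW.
move: leW leUI (nonsingular_on_rank nsU) (leq_independence_number indI).
rewrite -/(skew_rank F arc); move: #|W| #|U| #|I| => w u i; lia.
Qed.

(** * Counting edges against an independent set *)

Section EdgeCount.
Variables (T : finType) (arc : rel T).
Hypothesis ori : oriented arc.
Let e := underlying arc.

Lemma card_underlying : #|[set a : T * T | e a.1 a.2]| = (2 * num_arcs arc)%N.
Proof.
pose A := [set a : T * T | arc a.1 a.2].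
have eE : [set a : T * T | e a.1 a.2] = A :|: [set (a.2, a.1) | a in A].
  apply/setP => -[x y]; rewrite !inE /= /e /underlying; congr (_ || _).
  apply/idP/imsetP => [ayx|[[u v]]]; first by exists (y, x); rewrite ?inE.
  by rewrite inE /= => auv [-> ->].
rewrite eE cardsU disjoint_setI0 ?cards0 ?subn0.
  by rewrite card_imset ?mul2n ?addnn // => -[x y] [u v] [-> ->].
apply/pred0P => -[x y] /=; apply/negP => /andP[]; rewrite inE /= => axy.
case/imsetP => -[u v]; rewrite inE /= => auv [xv yu].
by have := ori.2 x y; rewrite axy xv yu auv.
Qed.

Lemma card_neq_pairs (I : {set T}) :
  #|[set a : T * T | [&& a.1 != a.2, a.1 \in I & a.2 \in I]]| = (#|I| * #|I|.-1)%N.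
Proof.
set N := [set a | _].
have := cardsID [set a : T * T | a.1 == a.2] (setX I I).
have -> : setX I I :\: [set a | a.1 == a.2] = N.
  by apply/setP => a; rewrite !inE.
have -> : setX I I :&: [set a | a.1 == a.2] = [set (x, x) | x in I].
  apply/setP => -[x y]; rewrite !inE /=; apply/idP/imsetP => [/andP[/andP[xI _] /eqP<-]|].
    by exists x.
  by case=> z zI [-> ->]; rewrite zI eqxx.
rewrite cardsX card_imset => [|x y [->] //].
by case: #|I| => [|k]; rewrite /= ?mulSn ?mulnS => /eqP; rewrite ?eqn_add2l; lia.
Qed.

(** Ordered pairs of distinct vertices of [I] and ordered adjacent pairs form disjoint sets off the
    diagonal. Equality means that they exhaust it: every pair not inside [I] is an edge. *)
Lemma edge_count (I : {set T}) : independent e I ->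
  (#|I| * #|I|.-1 + 2 * num_arcs arc
    <= #|T| * #|T|.-1 ?= iff
      [forall x, forall y, e x y == (x != y) && ~~ ((x \in I) && (y \in I))])%N.
Proof.
move=> /independentP indI; rewrite -card_underlying -card_neq_pairs.
set N := [set a | _]; set E := [set a | _].
have -> : (#|T| * #|T|.-1)%N = #|[set a : T * T | a.1 != a.2]|.
  rewrite -cardsT -card_neq_pairs; apply: eq_card => a.
  by rewrite !inE !andbT.
have disj : N :&: E = set0.
  apply/setP => -[x y]; rewrite !inE /=; apply/negP => /andP[/and3P[_ xI yI]].
  by apply/negP; apply: indI.
have <- : #|N :|: E| = (#|N| + #|E|)%N by rewrite cardsU disj cards0 subn0.
have sub : N :|: E \subset [set a | a.1 != a.2].
  apply/subsetP => -[x y]; rewrite !inE /= => /orP[/and3P[]//|].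
  by apply: contraTneq => <-; rewrite /e underlying_irrefl.
have [le eqc] := subset_leqif_cards sub.
split=> //; rewrite eqc; apply/eqP/forallP => [NE x|eE].
  apply/forallP => y; have /setP/(_ (x, y)) := NE; have /setP/(_ (x, y)) := disj.
  rewrite !inE /=; case: (x != y); case: (x \in I); case: (y \in I); by case: (e x y).
apply/setP => -[x y]; have /forallP/(_ y)/eqP exy := eE x.
rewrite !inE /= exy; by case: (x != y); case: (x \in I); case: (y \in I).
Qed.

End EdgeCount.

(** * Estimates of the skew-rank *)

(** The matrix lives on row [c] and column [c], each of rank at most 1. The entry at [(c, c)],
    counted twice in the sum, is zero. *)
Lemma rank_skew_star (F : fieldType) n (arc : rel 'I_n) (c : 'I_n) :
  (forall x y, underlying arc x y -> (x == c) || (y == c)) -> ~~ arc c c ->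
  (skew_rank F arc <= 2)%N.
Proof.
move=> star acc; rewrite /skew_rank; set S := skew_adj F arc.
have S0 x y : ~~ underlying arc x y -> S x y = 0.
  by rewrite -(skew_adj_neq0 F) negbK => /eqP.
have -> : S = delta_mx c c *m S + S *m delta_mx c c.
  apply/matrixP => i j; rewrite [RHS]mxE.
  have -> : (delta_mx c c *m S) i j = (i == c)%:R * S i j.
    rewrite mxE (bigD1 c) //= big1 ?addr0 => [|k kc]; last first.
      by rewrite mxE (negbTE kc) andbF mul0r.
    by rewrite mxE eqxx andbT; case: eqP => [->|]; rewrite ?mul0r.
  have -> : (S *m delta_mx c c) i j = (j == c)%:R * S i j.
    rewrite mxE (bigD1 c) //= big1 ?addr0 => [|k kc]; last first.
      by rewrite [delta_mx _ _ _ _]mxE (negbTE kc) mulr0.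
    by rewrite [delta_mx _ _ _ _]mxE eqxx mulrC /=; case: eqP => [->|]; rewrite ?mul0r.
  have [->|ic] := eqVneq i c; have [->|jc] := eqVneq j c; rewrite ?mul1r ?mul0r ?addr0 ?add0r //.
    by rewrite S0 ?addr0 // /underlying orbb.
  by rewrite S0 //; apply/negP => /star; rewrite (negbTE ic) (negbTE jc).
apply: leq_trans (mxrank_add _ _) _; rewrite -(addn1 1).
apply: leq_add; [apply: leq_trans (mxrankM_maxl _ _) _ | apply: leq_trans (mxrankM_maxr _ _) _];
  by rewrite mxrank_delta.
Qed.

Lemma skew_adj_tr (F : pzRingType) n (arc : rel 'I_n) :
  oriented arc -> (skew_adj F arc)^T = - skew_adj F arc.
Proof.
move=> [_ anti]; apply/matrixP => i j; rewrite !mxE.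
by have := anti i j; case: (arc i j); case: (arc j i); rewrite //= ?opprK ?oppr0.
Qed.

(** Skew-symmetry in odd order gives [\det S = - \det S], so the determinant vanishes in
    characteristic 0. *)
Lemma odd_skew_rank (R : numFieldType) n (arc : rel 'I_n) :
  oriented arc -> odd n -> (skew_rank R arc < n)%N.
Proof.
move=> ori oddn; rewrite ltn_neqAle rank_leq_row andbT -/(row_full _) row_full_unit.
rewrite unitmxE unitfE negbK; set S := skew_adj R arc.
have : \det S = - \det S.
  by rewrite -{1}det_tr skew_adj_tr // -scaleN1r detZ -signr_odd oddn expr1 mulN1r.
by move/eqP; rewrite -addr_eq0 -mulr2n mulrn_eq0.
Qed.

Lemma skew_rank_gt0 (F : fieldType) n (arc : rel 'I_n) :
  (0 < num_arcs arc)%N -> (0 < skew_rank F arc)%N.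
Proof.
case/card_gt0P => -[x y]; rewrite inE /= => axy.
rewrite lt0n mxrank_eq0; apply/negP => /eqP S0.
by have := skew_adj_neq0 F arc x y; rewrite S0 mxE eqxx /underlying axy.
Qed.

(** * From the integer counts to the real bound *)

(* [a] and [s] stand for the independence number and the skew-rank.  Since
   [a (a-1) <= n (n-1) - 2m] amounts to [a - 1/2 <= sqrt (n (n-1) - 2m + 1/4)],
   the bound is the sum of the two hypotheses. *)
Lemma bound_from_counts (R : rcfType) (n m s a : nat) :
  (0 < n)%N -> (0 < a)%N -> (4 * n <= s + 2 * a + 2 * m + 2)%N ->
  (a * a.-1 + 2 * m <= n * n.-1)%N ->
  let rhs := 4 * n%:R - 2 * m%:R
             - Num.sqrt (n%:R * (n%:R - 1) - 2 * m%:R + 1 / 4) - 5 / 2 : R in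
  rhs <= (s + a)%:R /\
  ((s + a)%:R = rhs <->
    (s + 2 * a + 2 * m + 2 = 4 * n)%N /\ (a * a.-1 + 2 * m = n * n.-1)%N).
Proof.
case: n a => [//|n] [//|a] _ _ /= h1 h2.
(* From here on [n] and [a] denote the predecessors of the original values. *)
rewrite -[n.+1]addn1 -[a.+1]addn1 in h1 h2 *; set rhs := _ - 5 / 2.
have H1 : 4 * (n%:R + 1) <= s%:R + 2 * (a%:R + 1) + 2 * m%:R + 2 :> R.
  by move: h1; rewrite -(ler_nat R); lra.
have H2 : (a%:R + 1) * a%:R + 2 * m%:R <= (n%:R + 1) * n%:R :> R.
  by move: h2; rewrite -(ler_nat R); lra.
have E1 : (s + 2 * (a + 1) + 2 * m + 2 = 4 * (n + 1))%N <->
    s%:R + 2 * (a%:R + 1) + 2 * m%:R + 2 = 4 * (n%:R + 1) :> R.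
  by split=> [/eqP|E]; [|apply/eqP]; rewrite -(eqr_nat R); [move/eqP|apply/eqP]; lra.
have E2 : ((a + 1) * a + 2 * m = (n + 1) * n)%N <->
    (a%:R + 1) * a%:R + 2 * m%:R = (n%:R + 1) * n%:R :> R.
  by split=> [/eqP|E]; [|apply/eqP]; rewrite -(eqr_nat R); [move/eqP|apply/eqP]; lra.
suff [le iff] : rhs <= s%:R + (a%:R + 1) /\ (s%:R + (a%:R + 1) = rhs <->
    s%:R + 2 * (a%:R + 1) + 2 * m%:R + 2 = 4 * (n%:R + 1) :> R /\
    (a%:R + 1) * a%:R + 2 * m%:R = (n%:R + 1) * n%:R :> R).
  rewrite !natrD; split=> //; split=> [/iff[/E1 ? /E2 ?] //|[/E1 ? /E2 ?]].
  exact/iff.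
rewrite /rhs !natrD addrK; move: H1 H2 (ler0n R a).
move: (n%:R : R) (a%:R : R) (m%:R : R) (s%:R : R) => N A M S H1 H2 A0.
set D := _ + 1 / 4.
have AD : (A + 1 / 2) ^+ 2 <= D by rewrite /D; lra.
have D0 : 0 <= D by apply: le_trans AD; apply: sqr_ge0.
have sq := sqr_sqrtr D0; have q0 := sqrtr_ge0 D.
move: (Num.sqrt D) sq q0 => q sq q0.
have Aq : A + 1 / 2 <= q by rewrite -sq ler_pXn2r // ?nnegrE //  in AD; lra.
(* Two inequalities whose sum is tight are both tight; conversely, [E'] makes [D] the square of
   [A + 1 / 2]. *)
split; first lra; split=> [E|[E E']].
  have qE : q = A + 1 / 2 by lra.
  by split; [lra|rewrite qE /D in sq; lra].
have : q ^+ 2 = (A + 1 / 2) ^+ 2 by rewrite sq /D; lra.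
by move/eqP; rewrite eqrXn2 //; [move/eqP|]; lra.
Qed.

(** * The extremal graphs *)

Lemma graph_iso_star n (e : rel 'I_n) (c : 'I_n) :
  (forall x y, e x y = (x != y) && ((x == c) || (y == c))) ->
  graph_iso e (star_rel n).
Proof.
move=> eE; have n0 : (0 < n)%N by apply: leq_trans (ltn_ord c).
(* The transposition of [c] and 0 moves the centre to its standard place. *)
pose z := Ordinal n0; exists (tperm c z); split; first exact: injF_bij perm_inj.
move=> x y; rewrite eE /star_rel (inj_eq perm_inj).
have zE u : (val (tperm c z u) == 0%N) = (u == c).
  by rewrite -[0%N]/(val z) val_eqE -{2}(tpermL c z) (inj_eq perm_inj).
by rewrite !zE.
Qed.

Lemma star_iso_center n (e : rel 'I_n) : (0 < n)%N ->
  graph_iso e (star_rel n) ->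
  exists c, forall x y, e x y = (x != y) && ((x == c) || (y == c)).
Proof.
move=> n0 [f [bf fE]]; have [g fK gK] := bf; exists (g (Ordinal n0)) => x y.
rewrite fE /star_rel (inj_eq (can_inj fK)) -[0%N]/(val (Ordinal n0)) !val_eqE.
by rewrite !(can2_eq fK gK).
Qed.

(** With [k = n - a], eliminating [m] gives [s = 2 a (1 - k) + k (5 - k) - 2]. For [k = 2] this is
    [4 - 2 a], and for [k >= 3] it is at most [k (3 - k) <= 0]; but [m > 0], hence [s > 0], once
    [k >= 1]. *)
Lemma star_or_triangle_counts (n m s a : nat) :
  (0 < a <= n)%N -> (m = 0%N \/ 0 < s)%N ->
  (s + 2 * a + 2 * m + 2 = 4 * n)%N -> (a * a.-1 + 2 * m = n * n.-1)%N ->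
  (n <= a.+1)%N \/ (n = 3 /\ a = 1)%N.
Proof.
case: a => // a; rewrite /= => an; rewrite -(subnKC an); move: (n - a.+1)%N => k.
case: k => [|[|[|k]]] ms E1 E2; try (left; lia).
  by right; case: ms => ms; nia.
by exfalso; case: ms => ms; nia.
Qed.

(** * The bound and its equality cases *)

Theorem theorem1p4 (R : rcfType) (n : nat) (arc : rel 'I_n) :
  (0 < n)%N ->
  oriented arc ->
  connected_graph (underlying arc) ->
  let m := num_arcs arc in
  let lhs := ((skew_rank R arc + independence_number (underlying arc))%N)%:R : R in
  let rhs := 4 * n%:R - 2 * m%:R
             - Num.sqrt (n%:R * (n%:R - 1) - 2 * m%:R + 1 / 4) - 5 / 2 : R in
  rhs <= lhs /\
  (lhs = rhs <->
     (graph_iso (underlying arc) (star_rel n) \/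
      graph_iso (underlying arc) triangle_rel)).
Proof.
move=> n0 ori conn m lhs rhs.
have a0 := independence_number_gt0 (Ordinal n0) (underlying_irrefl ori).
have [I indI cardI] := maximum_independent_set (underlying arc).
have [leI eqI] := edge_count ori indI.
have le1 := skew_rank_independence R n0 ori conn.
rewrite cardI card_ord -/m in leI eqI le1.
have [le iff] := bound_from_counts R n0 a0 le1 leI.
split=> //; apply: iff_trans iff _; split=> [[E1 E2]|].
  have eE x y : underlying arc x y = (x != y) && ~~ ((x \in I) && (y \in I)).
    by move: eqI; rewrite E2 eqxx => /esym/forallP/(_ x)/forallP/(_ y)/eqP.
  have an : (0 < independence_number (underlying arc) <= n)%N.
    by rewrite a0 -cardI -[leqRHS]card_ord max_card.
  have ms : m = 0%N \/ (0 < skew_rank R arc)%N.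
    by case: (posnP m) => [|/(skew_rank_gt0 R)]; [left|right].
  have [le_n|[n3 a1]] := star_or_triangle_counts an ms E1 E2.
    (* At most one vertex lies outside [I]. If there is one, it is the centre of a star. *)
    left; have [/cards1P[c Ic]|CI] := boolP (#|~: I| == 1%N).
      apply: (@graph_iso_star _ _ c) => x y; rewrite eE negb_and.
      by have /setP Ic' := Ic; have := Ic' x; have := Ic' y; rewrite !inE => -> ->.
    (* Otherwise there are no edges, and connectedness leaves a single vertex. *)
    have IT : I = setT.
      apply/eqP; rewrite eqEcard subsetT cardsT card_ord.
      have := cardsC I; rewrite card_ord; lia.
    apply: (@graph_iso_star _ _ (Ordinal n0)) => x y.
    have -> : x = y; last by rewrite eqxx (underlying_irrefl ori).
    case/connectP: (conn x y) => -[|z s] //=.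
    by rewrite eE IT !inE andbF.
  (* With [#|I| = 1] no pair is excluded, so the graph is complete on three vertices. *)
  have eT : forall x y, underlying arc x y = (x != y).
    move=> x y; rewrite eE; have /cards1P[c ->] : #|I| == 1%N by rewrite cardI a1.
    by rewrite !inE; case: eqVneq => //= xy; apply: contra xy => /andP[/eqP-> /eqP->].
  right; rewrite /graph_iso; move: (underlying arc) eT; rewrite n3 => e eT.
  by exists id; split=> //; exists id.
(* By [edge_count], a nonempty independent [J] that contains every non-edge
   is a maximum independent set. *)
have suffJ (J : {set 'I_n}) : (0 < #|J|)%N ->
    (forall x y, underlying arc x y = (x != y) && ~~ ((x \in J) && (y \in J))) ->
    (#|J| * #|J|.-1 + 2 * m = n * n.-1 ->
      skew_rank R arc + 2 * #|J| + 2 * m + 2 <= 4 * n)%N ->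
    (skew_rank R arc + 2 * independence_number (underlying arc) + 2 * m + 2 = 4 * n)%N /\
    (independence_number (underlying arc) * (independence_number (underlying arc)).-1
      + 2 * m = n * n.-1)%N.
  move=> J0 eJ leJ.
  have indJ : independent (underlying arc) J.
    by apply/independentP => x y xJ yJ; rewrite eJ xJ yJ andbF.
  have [_] := edge_count ori indJ; rewrite card_ord -/m.
  have -> : [forall x, forall y, underlying arc x y == (x != y) && ~~ ((x \in J) && (y \in J))].
    by apply/forallP => x; apply/forallP => y; rewrite eJ.
  move/eqP => EJ; have {}leJ := leJ EJ.
  (* The map [t * t.-1] is strictly increasing on positive [t], hence the need for [J0] and [a0]. *)
  have aJ : (independence_number (underlying arc) <= #|J|)%N.
    by move: leI a0 J0; rewrite -EJ; case: (independence_number _) #|J| => [//|a] [//|b] /=; nia.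
  have aE : independence_number (underlying arc) = #|J|.
    by apply/eqP; rewrite eqn_leq aJ leq_independence_number.
  by rewrite aE in le1 *; split=> //; apply/eqP; rewrite eqn_leq leJ.
case=> [/(star_iso_center n0)[c ec]|[f [[g fK gK] fE]]].
  (* A single vertex is treated apart, because the complement of the centre would be empty. *)
  have [n1|n1] := leqP n 1.
    have {}n1 : n = 1%N by lia.
    have rk : (skew_rank R arc < n)%N by apply: odd_skew_rank; rewrite ?n1.
    apply: (suffJ setT) => [|x y|]; rewrite ?cardsT ?card_ord //; last first.
      by move: (skew_rank R arc) (m) rk => s k; rewrite n1; lia.
    have -> : x = y by apply: val_inj => /=; have := ltn_ord x; have := ltn_ord y; lia.
    by rewrite (underlying_irrefl ori) eqxx.
  have rk2 : (skew_rank R arc <= 2)%N.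
    by apply: (@rank_skew_star _ _ _ c) (ori.1 c) => x y; rewrite ec => /andP[].
  (* The leaves form [J]; then [m = n - 1], and the required inequality reduces to rank at most
     2. *)
  apply: (suffJ [set~ c]); rewrite ?cardsC1 ?card_ord; first by lia.
    by move=> x y; rewrite ec !inE negb_and !negbK.
  by move: (skew_rank R arc) (m) rk2 n1 => s k; case: (n) => [//|[//|l]] /=; nia.
have n3 : n = 3%N by rewrite -(card_ord n) -(card_ord 3); apply: bij_eq_card; exists g.
have rk : (skew_rank R arc < n)%N by apply: odd_skew_rank; rewrite ?n3.
(* Any single vertex serves as [J]; with [m = 3] the inequality again asks for rank at most 2, which
   odd order provides. *)
apply: (suffJ [set Ordinal n0]) => [|x y|]; rewrite ?cards1 //; last first.
  by move: (skew_rank R arc) (m) rk => s k; rewrite n3; lia.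
rewrite fE /triangle_rel (inj_eq (can_inj fK)) !inE.
by case: eqVneq => //= xy; apply/esym; apply: contra xy => /andP[/eqP-> /eqP->].
Qed.
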